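(* Let $G=G_1\times G_2$ be the direct product of two finite commutative groups, and let $A=A_1\times A_2$, where $A_1\subset G_1$ and $A_2\subset G_2$ are standard sets. Then \[ \lambda(A)=\lambda(A_1)\lambda(A_2),\qquad \lambda^+(A)=\lambda^+(A_1)\lambda^+(A_2), \] \[ \lambda^-(A_1)\lambda^-(A_2)\le\lambda^-(A)\le\lambda^-(A_1)\lambda^+(A_2),\qquad \lambda^\pm(A_1)\lambda^-(A_2)\le\lambda^\pm(A)\le\lambda^\pm(A_1)\lambda^+(A_2). \]
   Context: Groups are written additively. For a finite commutative group $H$, a set $A\subset H$ is a standard set if $A=-A$ and $0\in A$. A character of $H$ is a homomorphism $\gamma:H\to\{z\in\mathbb C:|z|=1\}$; $\hat H$ is the group of characters and $\mathbf 1$ the principal character. For $f:H\to\mathbb R$, $\hat f(\gamma)=\sum_{x\in H}\gamma(x)f(x)$. Classes of functions $f:H\to\mathbb R$ not identically zero: $\mathcal S(A)$: $f=0$ on $H\setminus A$; $\mathcal S^-(A)$: $f\le0$ on $H\setminus A$; $\mathcal S^+(A)$: $f=0$ on $H\setminus A$, $f\ge0$ on $A$; $\mathcal S^\pm(A)$: $f\le0$ on $H\setminus A$, $f\ge0$ on $A$. $\lambda(A)=\min\{f(0)/\hat f(\mathbf 1): f\in\mathcal S(A),\ \hat f\ge0\text{ on }\hat H\}$, and $\lambda^-,\lambda^+,\lambda^\pm$ are defined likewise with $\mathcal S^-,\mathcal S^+,\mathcal S^\pm$. For $A_i$ these are computed in $G_i$, for $A$ in $G$. *)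

(* Defs.v *)
From HB Require Import structures.
From mathcomp Require Import all_boot all_order all_algebra.
From mathcomp Require Import all_classical all_reals.
From mathcomp Require Import complex.

Set Implicit Arguments.
Unset Strict Implicit.
Unset Printing Implicit Defensive.

Import Order.TTheory GRing.Theory Num.Theory.
Local Open Scope ring_scope.
Local Open Scope complex_scope.

(* The library has the zmodType and the finType structures on a product, but
   not their join. *)
HB.instance Definition _ (G1 G2 : finZmodType) := Finite.on (G1 * G2)%type.

Definition standard_set (H : finZmodType) (A : {set H}) : Prop :=
  A = [set - x | x in A]%SET /\ 0 \in A.

Definition is_character (R : realType) (H : finZmodType) (g : H -> R[i]) :
    Prop :=
  (forall x, `|g x| = 1) /\ (forall x y, g (x + y) = g x * g y).

Definition principal_character (R : realType) (H : finZmodType) : H -> R[i] :=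
  fun _ => 1.
Arguments principal_character : clear implicits.

Definition fourier (R : realType) (H : finZmodType) (f : H -> R)
    (g : H -> R[i]) : R[i] :=
  \sum_(x : H) g x * (f x)%:C.

Definition not_identically_zero (R : realType) (H : finZmodType)
    (f : H -> R) : Prop :=
  exists x, f x <> 0.

Definition class_S (R : realType) (H : finZmodType) (A : {set H})
    (f : H -> R) : Prop :=
  not_identically_zero f /\ (forall x, x \notin A -> f x = 0).

Definition class_Sminus (R : realType) (H : finZmodType) (A : {set H})
    (f : H -> R) : Prop :=
  not_identically_zero f /\ (forall x, x \notin A -> f x <= 0).

Definition class_Splus (R : realType) (H : finZmodType) (A : {set H})
    (f : H -> R) : Prop :=
  [/\ not_identically_zero f,
      forall x, x \notin A -> f x = 0
    & forall x, x \in A -> 0 <= f x].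

Definition class_Spm (R : realType) (H : finZmodType) (A : {set H})
    (f : H -> R) : Prop :=
  [/\ not_identically_zero f,
      forall x, x \notin A -> f x <= 0
    & forall x, x \in A -> 0 <= f x].

(* The order on R[i] makes [0 <= z] mean that z is real and nonnegative.
   When [fourier f 1 = 0] the quotient f(0) / fourier f 1 is +oo (f(0) > 0 as
   f is a nonzero function with nonnegative transform), so it never realizes
   the minimum; such f are excluded because division by 0 in R[i] gives 0. *)
Definition quotients (R : realType) (H : finZmodType)
    (C : (H -> R) -> Prop) : set R :=
  [set q | exists f : H -> R,
    [/\ C f,
        forall g : H -> R[i], is_character g -> 0 <= fourier f g,
        fourier f (principal_character R H) != 0
      & q%:C = (f 0)%:C / fourier f (principal_character R H)]]%classic.

(* The least element of E; the value is 0 if E has none. *)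
Definition minimum (R : realType) (E : set R) : R :=
  xget 0 [set m | E m /\ lbound E m]%classic.

Definition lambda (R : realType) (H : finZmodType) (A : {set H}) : R :=
  minimum (quotients (@class_S R H A)).

Definition lambda_minus (R : realType) (H : finZmodType) (A : {set H}) : R :=
  minimum (quotients (@class_Sminus R H A)).

Definition lambda_plus (R : realType) (H : finZmodType) (A : {set H}) : R :=
  minimum (quotients (@class_Splus R H A)).

Definition lambda_pm (R : realType) (H : finZmodType) (A : {set H}) : R :=
  minimum (quotients (@class_Spm R H A)).

(* Main.v *)
Require Import Defs.
From HB Require Import structures.
From mathcomp Require Import all_boot all_order all_algebra.
From mathcomp Require Import all_fingroup all_solvable all_field all_character.
From mathcomp Require Import all_classical all_reals all_analysis.
From mathcomp Require Import complex.

Set Implicit Arguments.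
Unset Strict Implicit.
Unset Printing Implicit Defensive.

Import Order.TTheory GRing.Theory Num.Theory.
Import numFieldNormedType.Exports.
Local Open Scope ring_scope.
Local Open Scope complex_scope.

(* The tensor product of optimal functions on G1 and G2 gives the upper bounds.
   For the lower bounds, restrict a function f on G1 x G2 to the slice
   u(x) = f(x, 0) and project it to the marginal v(y) = sum_x f(x, y): both have
   nonnegative transforms, and since sum u = v(0) the quotient f(0) / sum f is
   the product of the quotients of u and v. The minima exist by compactness,
   because nonnegativity of the transform forces |f(x)| <= f(0). *)

(** * Characters separating points *)

(** In characteristic 0 the polynomial ['X^n - 1] is separable, so it has [n] distinct roots, and
    [n] distinct [n]-th roots of unity always include a primitive one. *)
Lemma prim_root_exists (F : numClosedFieldType) (n : nat) :
  (0 < n)%N -> exists z : F, n.-primitive_root z.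
Proof.
move=> n_gt0; have [r Dp] := closed_field_poly_normal ('X^n - 1 : {poly F}).
rewrite (monicP _) ?monicXnsubC // scale1r in Dp.
have rn1: all n.-unity_root r by apply/allP=> z; rewrite -root_prod_XsubC -Dp.
have sz_r: (n < (size r).+1)%N.
  by rewrite -(size_prod_XsubC r id) -Dp size_XnsubC.
have [|z _ pz] := hasP (has_prim_root n_gt0 rn1 _ sz_r); last by exists z.
by rewrite -separable_prod_XsubC -Dp separable_Xn_sub_1 // pnatr_eq0 -lt0n.
Qed.

(* A linear character over algC takes values in the group of N-th roots of
   unity; its discrete logarithm transports it to R[i]. *)
Lemma character_separates (R : realType) (H : finZmodType) (x : H) :
  x != 0 -> exists2 g : H -> R[i], is_character g & g x != 1.
Proof.
move=> x0; pose G := [set: H]%G; pose N := #|H|.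
have N0 : (0 < N)%N by apply/card_gt0P; exists x.
have cG : abelian G by exact: FinRing.zmod_abelian.
have linG i : 'chi[G]_i \is a linear_char by apply/char_abelianP.
have [i chix] : exists i, 'chi[G]_i x != 1.
  (* A point at which all linear characters equal 1 lies in the derived subgroup, which is trivial
     here. *)
  apply/existsP; apply: contraT; rewrite negb_exists => /forallP allk.
  case/negP: x0; have : x \in G^`(1)%g.
    rewrite -cap_cfker_lin_irr; apply/bigcapP => i _.
    rewrite cfkerEchar ?irr_char// inE finset.in_setT /= lin_char1 //.
    by have := allk i; rewrite negbK.
  by rewrite (derG1P cG) => /set1P ->.
have [z pz] := C_prim_root_exists N0.
have [w pw] := @prim_root_exists (complex R) _ N0.
have chiN y : 'chi[G]_i y ^+ N = 1.
  have -> : N = #|G| by rewrite cardsT.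
  by rewrite -lin_charX ?inE // expg_cardG ?inE // lin_char1.
pose k y : nat := projT1 (prim_rootP pz (chiN y)).
have kE y : 'chi[G]_i y = z ^+ k y by rewrite /k; case: prim_rootP.
exists (fun y => w ^+ k y); first split.
- move=> y; apply/eqP; rewrite -(@pexpr_eq1 _ _ N) // -normrX exprAC.
  by rewrite (prim_expr_order pw) expr1n normr1.
(* Equality of powers means congruence of exponents modulo [N], for [w] as for [z], so
   multiplicativity passes from [z] to [w]. *)
- move=> a b; rewrite -exprD; apply/eqP.
  rewrite (eq_prim_root_expr pw) -(eq_prim_root_expr pz) exprD -!kE.
  by rewrite -lin_charM ?inE.
apply: contra chix; rewrite kE -(expr0 w) -(expr0 z).
by rewrite (eq_prim_root_expr pw) (eq_prim_root_expr pz).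
Qed.

(** * Orthogonality of characters *)

Section Characters.
Variables (R : realType) (H : finZmodType).
Implicit Types g : H -> R[i].

Lemma principal_is_character : is_character (principal_character R H).
Proof. by split=> *; rewrite /principal_character ?normr1 ?mulr1. Qed.

Lemma character0 g : is_character g -> g 0 = 1.
Proof.
move=> [g1 gD]; have g0 : g 0 != 0 by rewrite -normr_eq0 g1 oner_eq0.
by apply: (mulfI g0); rewrite -gD addr0 mulr1.
Qed.

Lemma character_prod (I : finType) (X : I -> H -> R[i]) (k : I -> nat) :
  (forall i, is_character (X i)) ->
  is_character (fun y => \prod_i X i y ^+ k i).
Proof.
move=> hX; split=> [y|y z].
  by rewrite normr_prod big1 // => i _; rewrite normrX (hX i).1 expr1n.
by rewrite -big_split; apply: eq_bigr => i _; rewrite (hX i).2 exprMn.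
Qed.

Lemma character_expr_card g y : is_character g -> g y ^+ #|H| = 1.
Proof.
move=> hg; have gM n : g y ^+ n = g (y *+ n).
  by elim: n => [|n IH]; rewrite ?character0 // exprS mulrS IH hg.2.
rewrite gM -[y *+ _]FinRing.zmodXgE.
have -> : #|H| = #|[set: H]%G| by rewrite cardsT.
by rewrite expg_cardG ?inE // FinRing.zmod1gE character0.
Qed.

(* Take all products of powers of a separating family (chi_x), x != 0: the sum
   over the exponents factors into geometric sums, and the factor of index y
   vanishes at y. *)
Lemma character_orthogonality :
  exists (I : finType) (X : I -> H -> R[i]) (c : R) (i0 : I),
    [/\ forall i, is_character (X i), 0 < c, X i0 = principal_character R H
      & forall y, \sum_i X i y = (c *+ (y == 0))%:C].
Proof.
have /boolp.choice[X hX] : forall x : H, exists g : H -> R[i],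
    is_character g /\ (x != 0 -> g x != 1).
  move=> x; have [->|x0] := eqVneq x 0; last first.
    by have [g hg gx] := character_separates R x0; exists g.
  (* Nothing has to be separated at [x = 0]; any character completes the family. *)
  exists (principal_character R H); split=> //.
  exact: principal_is_character.
have N0 : (0 < #|H|)%N by apply/card_gt0P; exists 0.
exists {ffun H -> 'I_#|H|}.
exists (fun (k : {ffun H -> 'I_#|H|}) y => \prod_x X x y ^+ k x).
(* The constant counts the exponent vectors, as characters may repeat in the family; later only its
   positivity matters. The zero vector gives the principal character. *)
exists (\prod_(x : H) #|H|%:R), [ffun => Ordinal N0]; split.
- by move=> k; apply: (@character_prod _ X) => x; have [] := hX x.
- by apply: prodr_gt0 => x _; rewrite ltr0n.
- apply: boolp.funext => y; rewrite /principal_character big1 // => x _.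
  by rewrite ffunE expr0.
move=> y; transitivity (\prod_x \sum_(k < #|H|) X x y ^+ k).
  by rewrite bigA_distr_bigA.
have [->|y0] := eqVneq y 0.
  rewrite mulr1n rmorph_prod; apply: eq_bigr => x _.
  under eq_bigr do rewrite (character0 (hX x).1) expr1n.
  by rewrite sumr_const card_ord rmorph_nat.
rewrite mulr0n rmorph0 (bigD1 y) //=.
suff -> : \sum_(k < #|H|) X y y ^+ k = 0 by rewrite mul0r.
have := subrX1 (X y y) #|H|.
rewrite character_expr_card ?subrr; last exact: (hX y).1.
by move/esym/eqP; rewrite mulf_eq0 subr_eq0 (negPf ((hX y).2 y0)) => /eqP.
Qed.

End Characters.

(** * Fourier inversion and functions with nonnegative transform *)

Definition nonneg_fourier (R : realType) (H : finZmodType) (f : H -> R) :=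
  forall g : H -> R[i], is_character g -> 0 <= fourier f g.

Section Fourier.
Variables (R : realType) (H : finZmodType).
Implicit Types (f : H -> R) (g : H -> R[i]).

Lemma fourier_principal f :
  fourier f (principal_character R H) = (\sum_x f x)%:C.
Proof. by rewrite rmorph_sum; apply: eq_bigr => x _; rewrite mul1r. Qed.

Lemma fourierZ (a : R) f g :
  fourier (fun x => a * f x) g = a%:C * fourier f g.
Proof.
by rewrite mulr_sumr; apply: eq_bigr => x _; rewrite rmorphM mulrCA.
Qed.

(** With [Im_fourier], this turns nonnegativity of the transform at [g] into conditions on two real
    linear forms in [f], hence into a closed condition. *)
Lemma Re_fourier f g : complex.Re (fourier f g) = \sum_x complex.Re (g x) * f x.
Proof.
rewrite /fourier raddf_sum; apply: eq_bigr => x _.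
by case: (g x) => a b /=; rewrite mulr0 subr0.
Qed.

Lemma Im_fourier f g : complex.Im (fourier f g) = \sum_x complex.Im (g x) * f x.
Proof.
rewrite /fourier raddf_sum; apply: eq_bigr => x _.
by case: (g x) => a b /=; rewrite mulr0 add0r.
Qed.

(** After exchanging the sums, [X i (- x) * X i y] is [X i (y - x)], and orthogonality keeps only
    [y = x]. *)
Lemma fourier_inversion (I : finType) (X : I -> H -> R[i]) (c : R) :
  (forall i, is_character (X i)) ->
  (forall y, \sum_i X i y = (c *+ (y == 0))%:C) ->
  forall f x, \sum_i X i (- x) * fourier f (X i) = (c * f x)%:C.
Proof.
move=> hX oX f x.
under eq_bigr do rewrite mulr_sumr.
rewrite exchange_big /= (bigD1 x) //= [X in _ + X]big1 ?addr0 => [|y yx].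
  under eq_bigr => i _ do rewrite mulrA -(hX i).2 addNr.
  by rewrite -mulr_suml oX eqxx rmorphM.
under eq_bigr => i _ do rewrite mulrA -(hX i).2.
by rewrite -mulr_suml oX addrC subr_eq0 (negPf yx) mulr0n mul0r.
Qed.

(** Inversion writes [c * f x] as a combination of nonnegative numbers with unimodular coefficients.
    At 0 all coefficients are 1, so the triangle inequality suffices. *)
Lemma norm_le_nonneg_fourier f x : nonneg_fourier f -> `|f x| <= f 0.
Proof.
move=> hf; have [I [X [c [i0 [hX c0 _ oX]]]]] := character_orthogonality R H.
have inv := fourier_inversion hX oX f.
rewrite -(ler_pM2l c0) -{1}(gtr0_norm c0) -normrM -lecR.
apply: le_trans (_ : `|(c * f x)%:C| <= _).
  exact: (normc_ge_Re (c * f x)%:C).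
rewrite -!inv; apply: le_trans (ler_norm_sum _ _ _) _; apply: ler_sum => i _.
by rewrite normrM (hX i).1 mul1r oppr0 character0 // mul1r ger0_norm // hf.
Qed.

(** By inversion at 0, [c * f 0] is a sum of nonnegative terms, and the term of the principal
    character is the positive sum of [f]. *)
Lemma nonneg_fourier_gt0 f : nonneg_fourier f -> 0 < \sum_x f x -> 0 < f 0.
Proof.
move=> hf s0.
have [I [X [c [i0 [hX c0 X0 oX]]]]] := character_orthogonality R H.
rewrite -(pmulr_rgt0 _ c0) -ltcR -(fourier_inversion hX oX) oppr0.
rewrite (bigD1 i0) //= ltr_pwDl //.
  by rewrite character0 // mul1r X0 fourier_principal ltcR.
by apply: sumr_ge0 => i _; rewrite character0 // mul1r hf.
Qed.

Lemma not_identically_zero_sum f :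
  0 < \sum_x f x -> not_identically_zero f.
Proof.
move=> s0; apply: boolp.contrapT => nz; move: s0; rewrite big1 ?ltxx // => x _.
by apply: boolp.contrapT => fx; apply: nz; exists x.
Qed.

(** Brings the quotients back to real numbers: the transform at the principal character is
    nonnegative and nonzero, hence positive. *)
Lemma quotientsP (C : (H -> R) -> Prop) (q : R) :
  quotients C q <-> exists f,
    [/\ C f, nonneg_fourier f, 0 < \sum_x f x & q = f 0 / \sum_x f x].
Proof.
split=> -[f [Cf hf]]; rewrite ?fourier_principal.
  move=> s0 qE; have sC : 0 <= (\sum_x f x)%:C.
    by rewrite -fourier_principal; apply/hf/principal_is_character.
  exists f; split=> //; last first.
    by apply: complexI; rewrite qE fmorph_div.
  by rewrite -ltcR lt_def sC s0.
move=> s0 ->; exists f; split=> //; rewrite fourier_principal ?fmorph_div //.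
by rewrite fmorph_eq0 gt_eqF.
Qed.

Lemma quotients_gt0 (C : (H -> R) -> Prop) (q : R) : quotients C q -> 0 < q.
Proof.
by case/quotientsP=> f [_ hf s0 ->]; rewrite divr_gt0 // nonneg_fourier_gt0.
Qed.

End Fourier.

(** * Existence of the minima by compactness *)

(** Rules out the default value 0 that [minimum] takes on a set without least element. *)
Definition minimum_attained (R : realType) (E : set R) : Prop :=
  E (minimum E) /\ lbound E (minimum E).

Lemma continuous_linear_combination (R : realType) (T : topologicalType)
    (I : Type) (s : seq I) (a : I -> R) (F : I -> T -> R) :
  (forall i, continuous (F i)) ->
  continuous (fun t => \sum_(i <- s) a i * F i t).
Proof.
move=> cF t; elim: s => [|i s IH].
  rewrite (_ : (fun t => _) = fun=> 0) ?big_nil; first exact: cvg_cst.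
  by apply: boolp.funext => u; rewrite big_nil.
rewrite (_ : (fun t => _) = fun t => a i * F i t + \sum_(j <- s) a j * F j t).
  by apply: cvgD; [apply: cvgMl_tmp; exact: cF | exact: IH].
by apply: boolp.funext => u; rewrite big_cons.
Qed.

Lemma linear_form_continuous (R : realType) (H : finType) (a : H -> R) :
  continuous (fun f : {ptws H -> R} => \sum_x a x * f x).
Proof.
apply: (@continuous_linear_combination R {ptws H -> R} _ _ a (fun x f => f x)).
exact: (@proj_continuous H (fun=> R)).
Qed.

Section Minimum.
Variables (R : realType) (H : finZmodType) (C : (H -> R) -> Prop).
(** [P x] holds the values permitted at [x]. Closed cones of values cover all four classes at once;
    [P0] and [P1] admit the Dirac function at 0. *)
Variable P : H -> set R.
Hypothesis CP : forall f, C f <-> not_identically_zero f /\ forall x, P x (f x).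
Hypothesis P_closed : forall x, closed (P x).
Hypothesis P_cone : forall x a r, 0 < a -> P x r -> P x (a * r).
Hypothesis P0 : forall x, P x 0.
Hypothesis P1 : P 0 1.

Let delta (x : H) : R := (x == 0)%:R.

(** Under the normalization [\sum_x f x = 1] the quotient is [f 0], and the function cannot vanish
    identically. The bounds by 1 make the set compact and lose no minimizer, since the Dirac
    function has quotient 1. *)
Let K : set {ptws H -> R} := [set f | [/\ forall x, -1 <= f x <= 1,
  forall x, P x (f x), nonneg_fourier (f : H -> R) & \sum_x f x = 1]]%classic.

Let sum_delta : \sum_x delta x = 1.
Proof.
by rewrite (bigD1 0) //= big1 ?addr0 /delta ?eqxx // => x /negPf ->.
Qed.

Let K_delta : K delta.
Proof.
split=> //.
- by move=> x; rewrite /delta; case: eqP => _;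
    rewrite -ler_norml ?normr1 ?normr0 ?ler01.
- by move=> x; rewrite /delta; case: eqP => [->|].
move=> g hg; rewrite /fourier (bigD1 0) //= big1 ?addr0.
  by rewrite character0 // mul1r /delta eqxx ler01.
by move=> x /negPf; rewrite /delta => ->; rewrite mulr0.
Qed.

(** A Tychonoff cube cut by closed conditions. *)
Let K_compact : compact K.
Proof.
pose B : set {ptws H -> R} :=
  [set f | forall x, [set` `[-1, 1]%R]%classic (f x)]%classic.
have cB : compact B.
  apply: (@tychonoff H (fun=> R) (fun=> [set` `[-1, 1]%R]%classic)) => x.
  exact: segment_compact.
have comp (h : {ptws H -> R} -> R) (D : set R) :
    continuous h -> closed D -> closed (h @^-1` D)%classic.
  by move=> ch; apply: (proj1 (continuous_closedP h)).
have cF : closed [set f : {ptws H -> R} | nonneg_fourier (f : H -> R)]%classic.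
  rewrite (_ : mkset _ = (\bigcap_(g in @is_character R H)
    ((fun f : {ptws H -> R} => \sum_x complex.Re (g x) * f x)
       @^-1` [set r | 0 <= r] `&`
     (fun f : {ptws H -> R} => \sum_x complex.Im (g x) * f x)
       @^-1` [set r | r = 0])))%classic.
    apply: closed_bigI => g _; apply: closedI; apply: comp.
    - exact: linear_form_continuous.
    - exact: closed_ge.
    - exact: linear_form_continuous.
    - exact: closed_eq.
  apply/seteqP; split=> f hf g hg; have := hf g hg;
    rewrite lecE /= Re_fourier Im_fourier.
    by case/andP=> /eqP.
  by case=> -> ->; rewrite eqxx.
have -> : K = (B `&`
    (\bigcap_(x in setT) (fun f : {ptws H -> R} => f x) @^-1` P x)
    `&` [set f | nonneg_fourier (f : H -> R)]
    `&` (fun f : {ptws H -> R} => \sum_x 1 * f x)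
       @^-1` [set r | r = 1])%classic.
  apply/seteqP; split=> f /=.
    case=> h1 h2 h3 h4; split; [split=> //; split|].
    + by move=> x /=; rewrite in_itv /= h1.
    + by move=> x _; exact: h2.
    + by under eq_bigr do rewrite mul1r.
  move=> [[[h1 h2] h3] h4]; split=> //.
  + by move=> x; exact: h2.
  + by rewrite -h4; under [RHS]eq_bigr do rewrite mul1r.
apply: compact_closedI; last first.
  by apply: comp; [exact: linear_form_continuous|exact: closed_eq].
apply: compact_closedI => //; apply: compact_closedI => //.
apply: closed_bigI => x _; apply: comp => //.
exact: (@proj_continuous H (fun=> R) x).
Qed.

Lemma quotients_minimum_attained : minimum_attained (quotients C).
Proof.
apply: (@xgetPex _ _ [set m | quotients C m /\ lbound (quotients C) m]%classic).
have [] := @compact_EVT_min {ptws H -> R} R (fun f => f 0) K.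
- by exists delta.
- exact: K_compact.
- by apply: continuous_subspaceT; exact: (@proj_continuous H (fun=> R) 0).
move=> f; rewrite inE => -[f1 fP hf sf] fmin; exists (f 0); split.
  apply/quotientsP; exists f; split=> //; rewrite ?sf ?ltr01 ?divr1 //.
  by apply/CP; split=> //; apply: not_identically_zero_sum; rewrite sf ltr01.
move=> q /quotientsP[h [/CP[_ hP] hh s0 qE]].
(* The Dirac function competes, so only quotients below 1 remain to be compared. *)
have fd : f 0 <= 1.
  by have := fmin delta; rewrite inE /delta eqxx; apply.
have [q1|q1] := leP 1 q; first exact: le_trans q1.
have s1 : 0 < (\sum_x h x)^-1 by rewrite invr_gt0.
have hh' : nonneg_fourier (fun x => (\sum_x h x)^-1 * h x).
  by move=> g hg; rewrite fourierZ mulr_ge0 ?hh // ler0c ltW.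
have := fmin (fun x => (\sum_x h x)^-1 * h x); rewrite inE qE mulrC; apply.
split=> //; last by rewrite -mulr_sumr mulVf // gt_eqF.
(* The normalized [h] is bounded by its value at 0, which is [q < 1], so it lies in the cube. *)
- move=> x; rewrite -ler_norml.
  apply: le_trans (norm_le_nonneg_fourier _ hh') _.
  by rewrite mulrC -qE ltW.
- by move=> x; apply: P_cone.
Qed.

End Minimum.

(** * Tensor products, slices and marginals *)

Section Product.
Variables (R : realType) (G1 G2 : finZmodType).
Implicit Types (u : G1 -> R) (v : G2 -> R) (f : (G1 * G2)%type -> R).

(** Generic in [S], to combine real functions as well as complex characters. *)
Definition tensor (S : pzSemiRingType) (T1 T2 : Type)
    (u1 : T1 -> S) (u2 : T2 -> S) : (T1 * T2)%type -> S :=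
  fun p => u1 p.1 * u2 p.2.

Definition slice f : G1 -> R := fun x => f (x, 0).
Definition marginal f : G2 -> R := fun y => \sum_x f (x, y).

Lemma tensor_is_character (g1 : G1 -> R[i]) (g2 : G2 -> R[i]) :
  is_character g1 -> is_character g2 -> is_character (tensor g1 g2).
Proof.
move=> [n1 d1] [n2 d2]; split=> [p|p q]; first by rewrite normrM n1 n2 mulr1.
by rewrite /tensor /= d1 d2 mulrACA.
Qed.

(** Since [(x, y) = (x, 0) + (0, y)], the restrictions to the two axes determine [g]. Positivity on
    a product thus needs testing on tensors only. *)
Lemma character_tensor (g : (G1 * G2)%type -> R[i]) : is_character g ->
  exists g1 g2, [/\ is_character g1, is_character g2 & g = tensor g1 g2].
Proof.
move=> [n d]; exists (fun x => g (x, 0)), (fun y => g (0, y)); split.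
- by split=> // x y; rewrite -d; congr g; congr pair; rewrite addr0.
- by split=> // x y; rewrite -d; congr g; congr pair; rewrite addr0.
apply: boolp.funext => -[x y]; rewrite /tensor -d /=; congr g.
by congr pair; rewrite ?addr0 ?add0r.
Qed.

Lemma fourier_tensor u v (g1 : G1 -> R[i]) (g2 : G2 -> R[i]) :
  fourier (tensor u v) (tensor g1 g2) = fourier u g1 * fourier v g2.
Proof.
rewrite /fourier mulr_suml; under [RHS]eq_bigr do rewrite mulr_sumr.
by rewrite pair_bigA; apply: eq_bigr => p _; rewrite rmorphM mulrACA.
Qed.

Lemma sum_tensor u v :
  \sum_p tensor u v p = (\sum_x u x) * (\sum_y v y).
Proof.
rewrite mulr_suml; under [RHS]eq_bigr do rewrite mulr_sumr.
by rewrite pair_bigA.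
Qed.

Lemma sum_marginal f : \sum_y marginal f y = \sum_p f p.
Proof. by rewrite exchange_big pair_bigA; apply: eq_bigr => -[]. Qed.

(** The transform of a marginal samples that of [f] at characters trivial on [G1], so it inherits
    nonnegativity. *)
Lemma fourier_marginal f (g2 : G2 -> R[i]) :
  fourier (marginal f) g2 = fourier f (tensor (principal_character R G1) g2).
Proof.
rewrite /fourier; under eq_bigr do rewrite rmorph_sum mulr_sumr.
rewrite exchange_big pair_bigA; apply: eq_bigr => -[x y] _.
by rewrite /tensor mul1r.
Qed.

Lemma nonneg_fourier_tensor u v :
  nonneg_fourier u -> nonneg_fourier v -> nonneg_fourier (tensor u v).
Proof.
move=> h1 h2 g /character_tensor[g1 [g2 [c1 c2 ->]]].
by rewrite fourier_tensor mulr_ge0 ?h1 ?h2.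
Qed.

Lemma nonneg_fourier_marginal f :
  nonneg_fourier f -> nonneg_fourier (marginal f).
Proof.
move=> hf g hg; rewrite fourier_marginal; apply: hf.
by apply: tensor_is_character => //; exact: principal_is_character.
Qed.

(* Averaging the transform of f over the characters of G2 extracts y = 0. *)
Lemma nonneg_fourier_slice f : nonneg_fourier f -> nonneg_fourier (slice f).
Proof.
move=> hf g hg.
have [I [X [c [_ [hX c0 _ oX]]]]] := character_orthogonality R G2.
have cC : 0 < c%:C by rewrite ltcR.
rewrite -(pmulr_rge0 _ cC).
suff -> : c%:C * fourier (slice f) g = \sum_i fourier f (tensor g (X i)).
  by apply: sumr_ge0 => i _; apply: hf; exact: tensor_is_character.
rewrite exchange_big /= mulr_sumr.
transitivity (\sum_x \sum_y \sum_i tensor g (X i) (x, y) * (f (x, y))%:C);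
  last first.
  by rewrite pair_bigA; apply: eq_bigr => -[].
apply: eq_bigr => x _; rewrite (bigD1 0) //= [X in _ + X]big1 ?addr0 => [|y y0].
  by rewrite -mulr_suml -mulr_sumr oX eqxx mulrCA mulrA.
by rewrite -mulr_suml -mulr_sumr oX (negPf y0) mulr0n mulr0 mul0r.
Qed.

Variables (C1 : (G1 -> R) -> Prop) (C2 : (G2 -> R) -> Prop).
Variable C : ((G1 * G2)%type -> R) -> Prop.

(** Both the value at 0 and the total sum are multiplicative on tensors, so the tensor of two
    minimizers has the product as its quotient. *)
Lemma minimum_le_mul :
  (forall u v, C1 u -> C2 v -> not_identically_zero (tensor u v) ->
    C (tensor u v)) ->
  minimum_attained (quotients C1) -> minimum_attained (quotients C2) ->
  minimum_attained (quotients C) ->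
  minimum (quotients C) <= minimum (quotients C1) * minimum (quotients C2).
Proof.
move=> CT [/quotientsP[u [c1 h1 s1 ->]] _] [/quotientsP[v [c2 h2 s2 ->]] _].
case=> _; apply; apply/quotientsP; exists (tensor u v).
have s : 0 < \sum_p tensor u v p by rewrite sum_tensor mulr_gt0.
split=> //; last by rewrite sum_tensor -mulf_div.
- by apply: CT => //; exact: not_identically_zero_sum.
- exact: nonneg_fourier_tensor.
Qed.

(* f(0) / sum f = (f1(0) / sum f1) (f2(0) / sum f2) for f1 the slice and f2 the
   marginal of f, because sum f1 = f2(0). *)
Lemma minimum_ge_mul :
  (forall f, C f -> not_identically_zero (slice f) -> C1 (slice f)) ->
  (forall f, C f -> not_identically_zero (marginal f) -> C2 (marginal f)) ->
  minimum_attained (quotients C1) -> minimum_attained (quotients C2) ->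
  minimum_attained (quotients C) ->
  minimum (quotients C1) * minimum (quotients C2) <= minimum (quotients C).
Proof.
move=> CS CM [q1 m1] [q2 m2] [/quotientsP[f [c h s ->]] _].
have hS := nonneg_fourier_slice h; have hM := nonneg_fourier_marginal h.
have sM : 0 < \sum_y marginal f y by rewrite sum_marginal.
(* The sum of the slice is by definition [marginal f 0], positive because the marginal has
   nonnegative transform and positive sum. *)
have sS : 0 < \sum_x slice f x by exact: nonneg_fourier_gt0 hM sM.
have -> : f 0 / \sum_p f p =
    slice f 0 / (\sum_x slice f x) * (marginal f 0 / \sum_y marginal f y).
  rewrite sum_marginal mulrA; congr (_ / _).
  by rewrite -[marginal f 0]/(\sum_x slice f x) divfK // gt_eqF.
apply: ler_pM; rewrite ?(ltW (quotients_gt0 q1)) ?(ltW (quotients_gt0 q2)) //.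
- apply: m1; apply/quotientsP; exists (slice f); split=> //.
  by apply: CS => //; exact: not_identically_zero_sum.
- apply: m2; apply/quotientsP; exists (marginal f); split=> //.
  by apply: CM => //; exact: not_identically_zero_sum.
Qed.

End Product.

(** * The minima of the four classes *)

Section Attained.
Variables (R : realType) (H : finZmodType) (A : {set H}).
Hypothesis A0 : 0 \in A.

(** For a fixed boolean guard the set is either [D] or the whole line. *)
Lemma closed_imply (b : bool) (D : set R) :
  closed D -> closed [set r | b -> D r]%classic.
Proof.
case: b => cD.
  by rewrite (_ : mkset _ = D) //; apply/seteqP; split=> r /=; auto.
by rewrite (_ : mkset _ = setT) ?predeqE //; exact: closedT.
Qed.

Lemma class_S_attained : minimum_attained (quotients (@class_S R H A)).
Proof.
apply: (@quotients_minimum_attained _ _ _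
  (fun x => [set r | x \notin A -> r = 0]%classic)) => //=.
- by move=> x; apply: closed_imply; exact: closed_eq.
- by move=> x a r a0 h xA; rewrite h // mulr0.
(* As [0 \in A], the value at 0 is unconstrained, so 1 is permitted there. *)
- by rewrite A0.
Qed.

Lemma class_Sminus_attained :
  minimum_attained (quotients (@class_Sminus R H A)).
Proof.
apply: (@quotients_minimum_attained _ _ _
  (fun x => [set r | x \notin A -> r <= 0]%classic)) => //=.
- by move=> x; apply: closed_imply; exact: closed_le.
- by move=> x a r a0 h xA; rewrite pmulr_rle0 // h.
- by rewrite A0.
Qed.

Lemma class_Splus_attained : minimum_attained (quotients (@class_Splus R H A)).
Proof.
apply: (@quotients_minimum_attained _ _ _ (fun x =>
  [set r | x \notin A -> r = 0] `&`
  [set r | x \in A -> 0 <= r])%classic) => //=.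
- move=> f; split=> [[n z p]|[n h]]; first by split=> // x; split; auto.
  by split=> // x; have [] := h x.
- move=> x; apply: closedI; apply: closed_imply;
    [exact: closed_eq|exact: closed_ge].
- move=> x a r a0 [h k]; split=> xA; first by rewrite h // mulr0.
  by rewrite pmulr_rge0 // k.
- by rewrite A0; split.
Qed.

Lemma class_Spm_attained : minimum_attained (quotients (@class_Spm R H A)).
Proof.
apply: (@quotients_minimum_attained _ _ _ (fun x =>
  [set r | x \notin A -> r <= 0] `&`
  [set r | x \in A -> 0 <= r])%classic) => //=.
- move=> f; split=> [[n z p]|[n h]]; first by split=> // x; split; auto.
  by split=> // x; have [] := h x.
- move=> x; apply: closedI; apply: closed_imply;
    [exact: closed_le|exact: closed_ge].
- move=> x a r a0 [h k]; split=> xA; first by rewrite pmulr_rle0 // h.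
  by rewrite pmulr_rge0 // k.
- by rewrite A0; split.
Qed.

End Attained.

(** * Behaviour of the classes under tensor, slice and marginal *)

Section Classes.
Variables (R : realType) (G1 G2 : finZmodType) (A1 : {set G1}) (A2 : {set G2}).
Hypotheses (A10 : 0 \in A1) (A20 : 0 \in A2).
Implicit Types (u : G1 -> R) (v : G2 -> R) (f : (G1 * G2)%type -> R).

Let A : {set (G1 * G2)%type} := finset.setX A1 A2.

Let in_slice x : ((x, 0) \in A) = (x \in A1).
Proof. by rewrite finset.in_setX A20 andbT. Qed.

Let notin_marginal x y : y \notin A2 -> (x, y) \notin A.
Proof. by rewrite finset.in_setX negb_and => ->; rewrite orbT. Qed.

Lemma class_Splus_ge0 (H : finZmodType) (B : {set H}) (h : H -> R) x :
  class_Splus B h -> 0 <= h x.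
Proof. by case=> _ z p; have [/p|/z ->] := boolP (x \in B). Qed.

Lemma class_S_tensor u v : class_S A1 u -> class_S A2 v ->
  not_identically_zero (tensor u v) -> class_S A (tensor u v).
Proof.
move=> [_ z1] [_ z2] nz; split=> // -[x y].
rewrite finset.in_setX negb_and /tensor /=.
by case/orP=> [/z1|/z2] ->; rewrite ?mul0r ?mulr0.
Qed.

Lemma class_Splus_tensor u v : class_Splus A1 u -> class_Splus A2 v ->
  not_identically_zero (tensor u v) -> class_Splus A (tensor u v).
Proof.
move=> c1 c2 nz; have [n1 z1 _] := c1; have [n2 z2 _] := c2.
have [_ z] := class_S_tensor (conj n1 z1) (conj n2 z2) nz.
split=> // p _.
by rewrite mulr_ge0 // (class_Splus_ge0 _ c1, class_Splus_ge0 _ c2).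
Qed.

(** The second factor is taken in [class_Splus] because two negative values off [A1] and [A2] would
    multiply to a positive one off [A]. This is the origin of [lambda_plus] in the upper bounds. *)
Lemma class_Sminus_tensor u v : class_Sminus A1 u -> class_Splus A2 v ->
  not_identically_zero (tensor u v) -> class_Sminus A (tensor u v).
Proof.
move=> [_ z1] c2 nz; have [_ z2 _] := c2; split=> // -[x y].
rewrite finset.in_setX negb_and /tensor /= => /orP[/z1 h|/z2 ->];
  last by rewrite mulr0.
by rewrite mulr_le0_ge0 // (class_Splus_ge0 _ c2).
Qed.

Lemma class_Spm_tensor u v : class_Spm A1 u -> class_Splus A2 v ->
  not_identically_zero (tensor u v) -> class_Spm A (tensor u v).
Proof.
move=> [n1 z1 p1] c2 nz; have [_ z] := class_Sminus_tensor (conj n1 z1) c2 nz.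
split=> // -[x y]; rewrite finset.in_setX => /andP[xA yA].
by rewrite mulr_ge0 ?p1 // (class_Splus_ge0 _ c2).
Qed.

(** As [0 \in A2], the slice meets [A] exactly over [A1]; slicing therefore preserves each of the
    four classes. *)
Lemma class_S_slice f : class_S A f ->
  not_identically_zero (slice f) -> class_S A1 (slice f).
Proof. by move=> [_ z] nz; split=> // x xA; apply: z; rewrite in_slice. Qed.

Lemma class_Sminus_slice f : class_Sminus A f ->
  not_identically_zero (slice f) -> class_Sminus A1 (slice f).
Proof. by move=> [_ z] nz; split=> // x xA; apply: z; rewrite in_slice. Qed.

Lemma class_Splus_slice f : class_Splus A f ->
  not_identically_zero (slice f) -> class_Splus A1 (slice f).
Proof.
by move=> [_ z p] nz; split=> // x xA; [apply: z|apply: p]; rewrite in_slice.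
Qed.

Lemma class_Spm_slice f : class_Spm A f ->
  not_identically_zero (slice f) -> class_Spm A1 (slice f).
Proof.
by move=> [_ z p] nz; split=> // x xA; [apply: z|apply: p]; rewrite in_slice.
Qed.

(** Over a point [y] outside [A2] the whole fibre lies outside [A]. *)
Lemma class_S_marginal f : class_S A f ->
  not_identically_zero (marginal f) -> class_S A2 (marginal f).
Proof.
move=> [_ z] nz; split=> // y yA; apply: big1 => x _.
by apply: z; exact: notin_marginal.
Qed.

Lemma class_Splus_marginal f : class_Splus A f ->
  not_identically_zero (marginal f) -> class_Splus A2 (marginal f).
Proof.
move=> cf nz; have [n z _] := cf; have [_ z2] := class_S_marginal (conj n z) nz.
by split=> // y _; apply: sumr_ge0 => x _; exact: class_Splus_ge0 cf.
Qed.

Lemma class_Sminus_marginal f : class_Sminus A f ->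
  not_identically_zero (marginal f) -> class_Sminus A2 (marginal f).
Proof.
move=> [_ z] nz; split=> // y yA; apply: sumr_le0 => x _.
by apply: z; exact: notin_marginal.
Qed.

(** The fibre over a point of [A2] may leave [A], where [f] can be negative, so the sign on [A2] is
    lost. Hence [lambda_minus] in the last lower bound. *)
Lemma class_Spm_marginal f : class_Spm A f ->
  not_identically_zero (marginal f) -> class_Sminus A2 (marginal f).
Proof. by case=> n z _; exact: class_Sminus_marginal. Qed.

End Classes.

Theorem theorem8p1 (R : realType) (G1 G2 : finZmodType)
    (A1 : {set G1}) (A2 : {set G2})
    (hA1 : standard_set A1) (hA2 : standard_set A2) :
  let A : {set (G1 * G2)%type} := finset.setX A1 A2 in
  [/\ lambda R A = lambda R A1 * lambda R A2,
      lambda_plus R A = lambda_plus R A1 * lambda_plus R A2,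
      lambda_minus R A1 * lambda_minus R A2 <= lambda_minus R A
        <= lambda_minus R A1 * lambda_plus R A2
    & lambda_pm R A1 * lambda_minus R A2 <= lambda_pm R A
        <= lambda_pm R A1 * lambda_plus R A2].
Proof.
case: hA1 hA2 => _ A10 [_ A20] A.
have A0 : 0 \in A by rewrite finset.in_setX A10.
split; [apply/eqP; rewrite eq_le | apply/eqP; rewrite eq_le | | ];
  apply/andP; split.
- apply: minimum_le_mul; try exact: class_S_attained.
  exact: class_S_tensor.
- apply: minimum_ge_mul; try exact: class_S_attained.
    exact: class_S_slice.
  exact: class_S_marginal.
- apply: minimum_le_mul; try exact: class_Splus_attained.
  exact: class_Splus_tensor.
- apply: minimum_ge_mul; try exact: class_Splus_attained.
    exact: class_Splus_slice.
  exact: class_Splus_marginal.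
- apply: minimum_ge_mul; try exact: class_Sminus_attained.
    exact: class_Sminus_slice.
  exact: class_Sminus_marginal.
(* The two factors come from different classes here, so the minimum of the second is supplied
   separately; likewise in the two cases below. *)
- apply: minimum_le_mul; try exact: class_Sminus_attained.
    exact: class_Sminus_tensor.
  exact: class_Splus_attained.
- apply: minimum_ge_mul; try exact: class_Spm_attained.
  + exact: class_Spm_slice.
  + exact: class_Spm_marginal.
  + exact: class_Sminus_attained.
- apply: minimum_le_mul; try exact: class_Spm_attained.
    exact: class_Spm_tensor.
  exact: class_Splus_attained.
Qed.
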